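(* Let $G$ be a signed graph on the vertex set $[n+1]$. A $(2,0,\ldots,0)$-flow $f$ on $G$ is a vertex of $\mathcal{F}_G(2,0,\ldots,0)$ if and only if it is the unique integer $(2,0,\ldots,0)$-flow on $G$ with support of one of the following forms: (i) $\{(v_1,v_2,-),\ldots,(v_{k-1},v_k,-)\}\cup\{(w_1,w_2,-),\ldots,(w_{l-1},w_l,-)\}\cup\{(w_l,v_k,+)\}$, where $v_1=w_1=1$, $2\le k,l$ and $v_1,\ldots,v_k,w_2,\ldots,w_l$ are distinct; (ii) $\{(1,z_1,-),(z_1,z_2,-),\ldots,(z_m,v_1,-)\}\cup\{(v_1,v_2,-),\ldots,(v_{k-1},v_k,-)\}\cup\{(w_1,w_2,-),\ldots,(w_{l-1},w_l,-)\}\cup\{(w_l,v_k,+)\}$, where $v_1=w_1$, $2\le k,l$ and $v_1,\ldots,v_k,w_2,\ldots,w_l$ are distinct; (iii) $\{(v_1,v_2,-),\ldots,(v_{k-1},v_k,-)\}\cup\{(v_1,v_k,+)\}$, where $1=v_1,\ldots,v_k$ are distinct; (iv) $\{(1,z_1,-),(z_1,z_2,-),\ldots,(z_m,v_1,-)\}\cup\{(v_1,v_2,-),\ldots,(v_{k-1},v_k,-)\}\cup\{(v_1,v_k,+)\}$, where $v_1,\ldots,v_k$ are distinct; (v) $\{(v_1,v_1,+)\}$; (vi) $\{(1,z_1,-),(z_1,z_2,-),\ldots,(z_m,v_1,-)\}\cup\{(v_1,v_1,+)\}$. (That is: there is a set $S$ of edges of $G$ of one of these forms such that $f$ is the unique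 integer $(2,0,\ldots,0)$-flow on $G$ with support $S$.)
   Context: A signed graph $G$ on $[n+1]=\{1,\ldots,n+1\}$ is a finite graph, loops and multiple edges allowed, each edge carrying a sign. A negative edge $(i,j,-)$ always has $i<j$; a positive edge between $i$ and $j$ is denoted $(i,j,+)$ (the order of the endpoints being irrelevant here); loops always have sign $+$ and are written $(i,i,+)$. To each edge associate a vector: $(i,j,-)\mapsto\mathbf{e}_i-\mathbf{e}_j$ for $i<j$, $(i,j,+)\mapsto\mathbf{e}_i+\mathbf{e}_j$ (so $(i,i,+)\mapsto2\mathbf{e}_i$). Let $M_G$ be the matrix with these vectors as columns. For $\mathbf{a}\in\mathbb{Z}^{n+1}$, an $\mathbf{a}$-flow on $G$ is a vector $f\in\mathbb{R}^{E(G)}_{\ge0}$ with $M_Gf=\mathbf{a}$, and $\mathcal{F}_G(\mathbf{a})$ is the set of all $\mathbf{a}$-flows; an integer $\mathbf{a}$-flow is one with integer entries. The support of a flow is the set of edges on which it is nonzero; each listed element $(i,j,\pm)$ of the support stands for one edge of $G$ of that type. In the initial paths $(1,z_1,-),\ldots,(z_m,v_1,-)$ the case $m=0$ is allowed, the path then being the single edge $(1,v_1,-)$. *)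

(* Defs.v *)
From mathcomp Require Import all_boot all_order all_algebra.
From mathcomp Require Import classical_sets reals.

Set Implicit Arguments.
Unset Strict Implicit.
Unset Printing Implicit Defensive.

Import Order.TTheory GRing.Theory Num.Theory.
Local Open Scope ring_scope.

(* The vertex set [n+1] = {1, ..., n+1} is 'I_n.+1, so vertex 1 is ord0. *)

Inductive sedge (n : nat) : Type :=
  | Neg of 'I_n.+1 & 'I_n.+1
  | Pos of 'I_n.+1 & 'I_n.+1.

(* Pos i j and Pos j i denote the same positive edge; Neg i j is ordered. *)
Definition same_sedge n (s t : sedge n) : bool :=
  match s, t with
  | Neg i j, Neg i' j' => (i == i') && (j == j')
  | Pos i j, Pos i' j' =>
      (i == i') && (j == j') || (i == j') && (j == i')
  | _, _ => false
  end.

(* [edges] need not be injective: distinct indices with the same value are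
   parallel edges.  The last field also forces every loop to be positive. *)
Record signed_graph (n : nat) : Type := SignedGraph {
  nb_edges : nat;
  edges : 'I_nb_edges -> sedge n;
  edges_ordered :
    forall e, if edges e is Neg i j then (i < j)%N else true
}.

Section Flows.
Variables (R : realType) (n : nat) (G : signed_graph n).

Definition sedge_vec (s : sedge n) : 'cV[R]_n.+1 :=
  match s with
  | Neg i j => delta_mx i 0 - delta_mx j 0
  | Pos i j => delta_mx i 0 + delta_mx j 0
  end.

Definition signed_mx : 'M[R]_(n.+1, nb_edges G) :=
  \matrix_(i, e) sedge_vec (edges e) i 0.

Definition flow_polytope (a : 'cV[int]_n.+1) : set 'cV[R]_(nb_edges G) :=
  [set f : 'cV[R]_(nb_edges G) |
    (forall e, 0 <= f e 0) /\ signed_mx *m f = map_mx intr a]%classic.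

Definition integer_flow (a : 'cV[int]_n.+1) (f : 'cV[R]_(nb_edges G)) : Prop :=
  flow_polytope a f /\ forall e, f e 0 \is a Num.int.

Definition flow_support (f : 'cV[R]_(nb_edges G)) : {set 'I_(nb_edges G)} :=
  [set e | f e 0 != 0]%SET.

End Flows.
Arguments flow_polytope {R n} G a.
Arguments integer_flow {R n} G a f.

(* Vertices of a polytope, as its extreme points. *)
Definition is_vertex (R : realType) (m : nat) (A : set 'cV[R]_m)
    (x : 'cV[R]_m) : Prop :=
  A x /\
  forall (y z : 'cV[R]_m) (t : R), A y -> A z -> 0 < t < 1 ->
    x = t *: y + (1 - t) *: z -> y = x /\ z = x.

Definition source_two (n : nat) : 'cV[int]_n.+1 :=
  \col_i (if i == ord0 then 2 else 0).

(* neg_path x [:: y1; ...; yp] = [:: (x,y1,-); (y1,y2,-); ...; (y(p-1),yp,-)] *)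
Definition neg_path n (x : 'I_n.+1) (s : seq 'I_n.+1) : seq (sedge n) :=
  pairmap (@Neg n) x s.

(* The path (1,z_1,-), ..., (z_m,v,-), which is the edge (1,v,-) if m = 0. *)
Definition stem n (zs : seq 'I_n.+1) (v : 'I_n.+1) : seq (sedge n) :=
  neg_path ord0 (rcons zs v).

(* vs and ws list v_2, ..., v_k and w_2, ..., w_l, so that v_k = last v1 vs and
   w_l = last v1 ws, and vs != [::] means 2 <= k. *)
Inductive vertex_form (n : nat) : seq (sedge n) -> Prop :=
  | VForm1 (vs ws : seq 'I_n.+1) of vs != [::] & ws != [::] & uniq (ord0 :: vs ++ ws) :
      vertex_form (neg_path ord0 vs ++ neg_path ord0 ws
                   ++ [:: Pos (last ord0 ws) (last ord0 vs)])
  | VForm2 (zs : seq 'I_n.+1) (v1 : 'I_n.+1) (vs ws : seq 'I_n.+1)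
      of vs != [::] & ws != [::] & uniq (v1 :: vs ++ ws) :
      vertex_form (stem zs v1 ++ neg_path v1 vs ++ neg_path v1 ws
                   ++ [:: Pos (last v1 ws) (last v1 vs)])
  | VForm3 (vs : seq 'I_n.+1) of uniq (ord0 :: vs) :
      vertex_form (neg_path ord0 vs ++ [:: Pos ord0 (last ord0 vs)])
  | VForm4 (zs : seq 'I_n.+1) (v1 : 'I_n.+1) (vs : seq 'I_n.+1)
      of uniq (v1 :: vs) :
      vertex_form (stem zs v1 ++ neg_path v1 vs ++ [:: Pos v1 (last v1 vs)])
  | VForm5 (v1 : 'I_n.+1) :
      vertex_form [:: Pos v1 v1]
  | VForm6 (zs : seq 'I_n.+1) (v1 : 'I_n.+1) :
      vertex_form (stem zs v1 ++ [:: Pos v1 v1]).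

(* S consists of exactly one edge of G for each entry of L. *)
Definition realizes n (G : signed_graph n) (S : {set 'I_(nb_edges G)})
    (L : seq (sedge n)) : Prop :=
  exists es : seq 'I_(nb_edges G),
    [/\ uniq es, S =i es & all2 (@same_sedge n) [seq edges e | e <- es] L].

(* Main.v *)
Require Import Defs.
From mathcomp Require Import all_boot all_order all_algebra.
From mathcomp Require Import classical_sets reals.
From mathcomp Require Import ring lra.

Set Implicit Arguments.
Unset Strict Implicit.
Unset Printing Implicit Defensive.

Import Order.TTheory GRing.Theory Num.Theory.
Local Open Scope ring_scope.

(** The normal form of the supports is a fork: a stem from vertex 1 to some v,
    two branches that leave v and share no further vertex, and a positive edge
    joining the ends of the branches.  Forms (i)-(iv) and (vi) are the forks
    sorted by whether the stem and the branches are trivial; (v) is a lone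
    loop, which is a fork when it sits at vertex 1.

    A flow supported on such a set is a vertex because it is the only flow
    supported there.  Negative edges increase the vertex, so in a fork no two
    negative edges end at the same vertex, and there is one positive edge
    ([vertex_form_tip_uniq]).  Take the difference h of two flows with such a
    support.  The net flow of h, summed over all vertices, is twice the flow
    of h through positive edges, so h vanishes on the positive edge; then, by
    descending induction on the head v of a negative edge, conservation at v
    kills h on the only edge entering v ([ker_tip_inj]).  If the flow is a
    convex combination of two others, those are supported there too, hence
    equal to it ([tip_inj_vertex]).

    Conversely let f be a vertex.  The total net flow 2 forces a positive edge
    in the support of f.  A vertex that sends flow out and is not the source
    receives flow through a negative edge, so both ends of the positive edge
    are reached from vertex 1 by negative edges of the support
    ([supp_reach]); cutting the two paths at their last common vertex gives a
    fork inside the support ([supp_fork]).  A fork carries an integer flow: 2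
    on the stem, 1 elsewhere ([fork_flow]).  A vertex equals every flow
    supported inside its own support ([vertex_support]), so f is that flow,
    and the same lemma gives the uniqueness. *)

(** * Sequences *)

Lemma all2_take (T U : Type) (r : T -> U -> bool) k s t :
  all2 r s t -> all2 r (take k s) (take k t).
Proof. by elim: k s t => [|k IH] [|x s] [|y t] //= /andP[-> /IH]. Qed.

Lemma all2_cat (T U : Type) (r : T -> U -> bool) s1 s2 t1 t2 :
  all2 r s1 t1 -> all2 r s2 t2 -> all2 r (s1 ++ s2) (t1 ++ t2).
Proof. by elim: s1 t1 => [|x s1 IH] [|y t1] //= /andP[-> /IH]. Qed.

Lemma uniq_map_inj (T U : eqType) (h : T -> U) (s : seq T) :
  uniq (map h s) -> {in s &, injective h}.
Proof.
move=> us x y xs ys hxy.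
rewrite -(nth_index x xs) -(nth_index x ys); congr nth; apply/eqP.
rewrite -(nth_uniq (h x) _ _ us) ?size_map ?index_mem //.
by rewrite !(nth_map x) ?index_mem // !nth_index // hxy.
Qed.

(** * Forks and the six forms *)

Section Edges.
Variable n : nat.
Implicit Types (s t : sedge n) (x u v : 'I_n.+1) (p vs ws : seq 'I_n.+1).

(** [None] marks positive edges, so that injectivity of [tip] on a set says
    at once that negative edges have distinct heads and that at most one edge
    is positive. *)
Definition tip s : option 'I_n.+1 := if s is Neg _ v then Some v else None.

Definition ordered s : bool := if s is Neg i j then (i < j)%N else true.

Definition below : rel 'I_n.+1 := [rel i j : 'I_n.+1 | (i < j)%N].

Lemma same_sedge_refl s : same_sedge s s.
Proof. by case: s => i j /=; rewrite !eqxx. Qed.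

Lemma same_sedge_NegP s u v : reflect (s = Neg u v) (same_sedge s (Neg u v)).
Proof.
apply: (iffP idP) => [|->]; last exact: same_sedge_refl.
by case: s => i j //= /andP[/eqP-> /eqP->].
Qed.

Lemma same_sedge_Posr i j k l :
  same_sedge (Pos i j : sedge n) (Pos k l) = same_sedge (Pos i j) (Pos l k).
Proof. by rewrite /= orbC. Qed.

Lemma same_sedge_tip s t : same_sedge s t -> tip s = tip t.
Proof. by move: s t => [i j|i j] [k l|k l] //= /andP[_ /eqP->]. Qed.

Lemma same_sedge_ordered s t : same_sedge s t -> ordered s = ordered t.
Proof. by move: s t => [i j|i j] [k l|k l] //= /andP[/eqP-> /eqP->]. Qed.

Lemma map_tip_neg_path x p : map tip (neg_path x p) = map some p.
Proof. by elim: p x => //= y p IH x; rewrite IH. Qed.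

Lemma all_ordered_neg_path x p : all ordered (neg_path x p) = path below x p.
Proof. by elim: p x => //= y p IH x; rewrite IH. Qed.

Definition fork p vs ws : seq (sedge n) :=
  let v := last ord0 p in
  neg_path ord0 p ++ neg_path v vs ++ neg_path v ws
    ++ [:: Pos (last v ws) (last v vs)].

Lemma map_tip_fork p vs ws :
  map tip (fork p vs ws) = rcons (map some (p ++ vs ++ ws)) None.
Proof.
by rewrite /fork !map_cat !map_tip_neg_path cats1 !rcons_cat -cats1.
Qed.

Lemma below_trans : transitive below.
Proof. by move=> y x z /= /ltn_trans; apply. Qed.

Lemma below_path_lt x p u : path below x p -> u \in p -> (x < u)%N.
Proof. by move/(order_path_min below_trans)/allP => h /h. Qed.

Lemma below_path_uniq x p : path below x p -> uniq (x :: p).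
Proof. by move=> hp; apply: (sorted_uniq below_trans) => // i; apply: ltnn. Qed.

Lemma below_path_le_last x p u :
  path below x p -> u \in p -> (u <= last x p)%N.
Proof.
elim: p x => //= y p IH x /andP[_ hp]; rewrite inE.
move=> /orP[/eqP->|/(IH y)]; last by apply.
case: p hp {IH} => [|z p] hp //; apply: ltnW.
by apply: (below_path_lt hp); apply: (mem_last z).
Qed.

(** Along the stem the vertices increase up to the branching vertex, and they
    exceed it on the branches, so disjointness of the branches suffices for
    all heads to be distinct. *)
Lemma fork_tip_uniq p vs ws :
  uniq (last ord0 p :: vs ++ ws) -> all ordered (fork p vs ws) ->
  uniq (map tip (fork p vs ws)).
Proof.
set v := last ord0 p => /= /andP[_ huv].
rewrite map_tip_fork !all_cat !all_ordered_neg_path -/v => /and4P[hp hv hw _].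
rewrite rcons_uniq map_inj_uniq; last by move=> i j [].
rewrite cat_uniq huv andbT; apply/andP; split; first by apply/mapP => -[].
have /= /andP[_ ->] := below_path_uniq hp; rewrite /=.
apply/hasPn => u hu; apply/negP => /(below_path_le_last hp); rewrite -/v leqNgt.
by move: hu; rewrite mem_cat => /orP[/(below_path_lt hv)|/(below_path_lt hw)] /= ->.
Qed.

(** The lone loop [Pos v1 v1] is treated apart, for it is a fork only when v1
    is the source. *)
Lemma vertex_form_tip_uniq (L : seq (sedge n)) :
  vertex_form L -> all ordered L -> uniq (map tip L).
Proof.
case=> [vs ws _ _ huv|zs v1 vs ws _ _ huv|vs huv|zs v1 vs huv|v1|zs v1] //.
- exact: (@fork_tip_uniq [::]).
- have := @fork_tip_uniq (rcons zs v1) vs ws.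
  by rewrite /fork last_rcons; apply.
- rewrite -[vs]cats0 in huv.
  exact: (@fork_tip_uniq [::] _ _ huv).
- have := @fork_tip_uniq (rcons zs v1) vs [::].
  by rewrite /fork last_rcons cats0; apply.
- have := @fork_tip_uniq (rcons zs v1) [::] [::].
  by rewrite /fork last_rcons; apply.
Qed.

(** The forms with a single branch name it vs, hence the requirement that ws be
    the trivial one. *)
Lemma fork_vertex_form p vs ws :
  uniq (last ord0 p :: vs ++ ws) -> (vs == [::] -> ws == [::]) ->
  vertex_form (fork p vs ws).
Proof.
rewrite /fork; case/lastP: p => [|zs v]; rewrite ?last_rcons.
- have [->|hv] := eqVneq vs [::].
    by move=> _ /(_ isT)/eqP->; apply: VForm5.
  have [->|hw] := eqVneq ws [::]; first by rewrite cats0 => hu _; apply: VForm3.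
  by move=> hu _; apply: VForm1.
- have [->|hv] := eqVneq vs [::].
    by move=> _ /(_ isT)/eqP->; apply: VForm6.
  have [->|hw] := eqVneq ws [::]; first by rewrite cats0 => hu _; apply: VForm4.
  by move=> hu _; apply: VForm2.
Qed.

(** As long as the two paths share a vertex u, the part of the first path up
    to u serves as a common initial segment of both; this shortens what
    remains.  Paths that increase repeat no vertex, so disjoint remainders are
    all that is asked. *)
Lemma fork_of_paths (e : rel 'I_n.+1) vs ws :
  subrel e below -> path e ord0 vs -> path e ord0 ws ->
  exists p vs' ws',
    [/\ path e ord0 (p ++ vs'), path e ord0 (p ++ ws'),
        uniq (last ord0 p :: vs' ++ ws'),
        last (last ord0 p) vs' = last ord0 vs
      & last (last ord0 p) ws' = last ord0 ws].
Proof.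
(* The induction needs an arbitrary common initial segment p in front. *)
move=> sub_e; rewrite -[vs]cat0s -[ws]cat0s; move: [::] => p.
have [m] := ubnP (size vs); elim: m p vs ws => // m IH p vs ws hm hv hw.
have [/hasP[u /splitPr uw /splitPr uv]|disj] := boolP (has (mem vs) ws).
  case: uv hm hv => v1 v2 hm hv; case: uw hw => w1 w2 hw.
  have e1 : p ++ v1 ++ u :: v2 = (p ++ rcons v1 u) ++ v2 by rewrite -catA cat_rcons.
  have h2 : path e ord0 ((p ++ rcons v1 u) ++ w2).
    move: hv; rewrite e1 !(cat_path _ _ (p ++ _)) => /andP[-> _].
    by move: hw; rewrite catA cat_path /= !last_cat last_rcons => /and3P[].
  have e2 : last ord0 (p ++ w1 ++ u :: w2) = last ord0 ((p ++ rcons v1 u) ++ w2).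
    by rewrite !last_cat last_rcons.
  rewrite e1 e2; apply: IH => //; last by rewrite -e1.
  by move: hm; rewrite size_cat /= ltnS => /(leq_trans _) -> //; rewrite ltn_addl.
exists p, vs, ws; split => //; rewrite ?last_cat //.
have up q : path e ord0 (p ++ q) -> path below (last ord0 p) q.
  by rewrite cat_path => /andP[_ /(sub_path sub_e)].
have /= /andP[v1 v2] := below_path_uniq (up _ hv).
have /= /andP[w1 w2] := below_path_uniq (up _ hw).
by rewrite /= mem_cat negb_or v1 w1 cat_uniq v2 w2 disj.
Qed.

End Edges.

(** * Uniqueness of the flow on a fork *)

Section Flows.
Variables (R : realType) (n : nat) (G : signed_graph n).
Local Notation E := 'I_(nb_edges G).
Local Notation M := (signed_mx R G).
Implicit Types (f g h y z : 'cV[R]_(nb_edges G)) (e : E) (es : seq E).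
Implicit Types (s : sedge n) (i j u v : 'I_n.+1).

Lemma sedge_vecE s v :
  sedge_vec R s v 0 = match s with
    | Neg i j => (v == i)%:R - (v == j)%:R
    | Pos i j => (v == i)%:R + (v == j)%:R
  end.
Proof. by case: s => i j; rewrite !mxE !andbT. Qed.

Lemma edge_ordered e : ordered (edges e).
Proof. by have := edges_ordered e. Qed.

Lemma signed_mxE f v : (M *m f) v 0 = \sum_e sedge_vec R (edges e) v 0 * f e 0.
Proof. by rewrite mxE; apply: eq_bigr => e _; rewrite mxE. Qed.

Lemma sum_sedge_vec s :
  \sum_v sedge_vec R s v 0 = (if tip s is Some _ then 0 else 2).
Proof.
have sum1 i : \sum_v (v == i)%:R = 1 :> R.
  by rewrite (bigD1 i) //= eqxx big1 ?addr0 // => v /negbTE->.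
under eq_bigr do rewrite sedge_vecE.
by case: s => i j /=; rewrite ?sumrB ?big_split /= !sum1 ?subrr.
Qed.

Lemma sum_net_flow f :
  \sum_v (M *m f) v 0 = \sum_(e | tip (edges e) == None) 2 * f e 0.
Proof.
under eq_bigr do rewrite signed_mxE.
rewrite exchange_big /= [RHS]big_mkcond; apply: eq_bigr => e _.
by rewrite -mulr_suml sum_sedge_vec; case: tip => [v|] //=; rewrite mul0r.
Qed.

(** Among the edges where h is nonzero, take a negative one with the largest
    head v: no other such edge enters v, and those leaving v would have a
    larger head, so conservation fails at v. *)
Lemma ker_tip_inj h (S : {set E}) :
  {in S &, injective (fun e => tip (edges e))} ->
  flow_support h \subset S -> M *m h = 0 -> h = 0.
Proof.
move=> injS /fintype.subsetP supS Mh.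
have inS e : h e 0 != 0 -> e \in S by move=> he; apply: supS; rewrite inE.
(* The only positive edge of S carries half of the total net flow, here 0. *)
have pos0 e : tip (edges e) = None -> h e 0 = 0.
  move=> te; apply/eqP/negPn/negP => he.
  have := sum_net_flow h; rewrite Mh big1; last by move=> v _; rewrite mxE.
  rewrite (bigD1 e) ?te //= big1 ?addr0.
    by move/eqP; rewrite eq_sym mulf_eq0 (negbTE he) pnatr_eq0.
  move=> e' /andP[/eqP te' ne]; apply/eqP; rewrite mulf_eq0; apply/orP; right.
  apply/negPn/negP => he'; case/eqP: ne.
  by apply: injS; rewrite ?inS ?te.
(* Induction on n.+1 - v is descending induction on the head v. *)
suff neg0 m e v : tip (edges e) = Some v -> (n.+1 - v < m)%N -> h e 0 = 0.
  apply/colP => e; rewrite [RHS]mxE; case te: (tip (edges e)) => [v|]; last exact: pos0.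
  exact: neg0 te (ltnSn _).
elim: m e v => // m IH e v te hm; apply/eqP/negPn/negP => he.
have := signed_mxE h v; rewrite Mh mxE (bigD1 e) //= big1 ?addr0.
  have := edge_ordered e; case: (edges e) te => [i j|//] [->]; rewrite /ordered => lt_iv.
  rewrite sedge_vecE eqxx; case: eqP => [vi|_]; first by rewrite vi ltnn in lt_iv.
  by move/eqP; rewrite sub0r mulN1r eq_sym oppr_eq0 (negbTE he).
move=> e' ne; have [->|he'] := eqVneq (h e' 0) 0; first by rewrite mulr0.
case te': (tip (edges e')) => [w|]; last by rewrite pos0 ?mulr0.
have vw : v == w = false.
  apply/eqP => vw; case/eqP: ne; apply: injS; rewrite ?inS //.
  by rewrite te te' vw.
case ee': (edges e') (te') (edge_ordered e') => [i j|//] [jw]; rewrite /ordered => lt_ij.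
rewrite sedge_vecE jw vw; case: (v =P i) => [vi|]; last by rewrite subrr mul0r.
rewrite (IH e' w te') ?mulr0 // -ltnS; apply: leq_trans hm; rewrite ltnS.
by rewrite vi -jw ltn_sub2l // (leq_trans lt_ij) // ltnW.
Qed.

Lemma flow_tip_inj a (S : {set E}) f g :
  {in S &, injective (fun e => tip (edges e))} ->
  flow_polytope G a f -> flow_polytope G a g ->
  flow_support f \subset S -> flow_support g \subset S -> f = g.
Proof.
move=> injS [_ Mf] [_ Mg] /fintype.subsetP fS /fintype.subsetP gS.
apply/eqP; rewrite -subr_eq0; apply/eqP; apply: ker_tip_inj injS _ _; last by rewrite mulmxBr Mf Mg subrr.
apply/fintype.subsetP => e; rewrite !inE !mxE => ne; apply/negPn/negP => eS.
case/eqP: ne.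
have /negPn/eqP-> : ~~ (f e 0 != 0) by apply: contra eS => h; apply: fS; rewrite inE.
have /negPn/eqP-> : ~~ (g e 0 != 0) by apply: contra eS => h; apply: gS; rewrite inE.
by rewrite subrr.
Qed.

Lemma tip_inj_vertex a (S : {set E}) f :
  {in S &, injective (fun e => tip (edges e))} ->
  flow_polytope G a f -> flow_support f \subset S ->
  is_vertex (flow_polytope G a) f.
Proof.
move=> injS Af fS; split=> // y z t Ay Az /andP[t0 t1] fE.
have [y0 _] := Ay; have [z0 _] := Az.
have supp e : e \notin S -> (y e 0 = 0) /\ (z e 0 = 0).
  move=> eS; have : f e 0 == 0.
    by apply: contraNT eS => he; apply: (fintype.subsetP fS); rewrite inE.
  rewrite fE !mxE; have t1' : 0 < 1 - t by rewrite subr_gt0.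
  have [ty tz] : 0 <= t * y e 0 /\ 0 <= (1 - t) * z e 0.
    by split; apply: mulr_ge0; rewrite ?(ltW t0) ?(ltW t1').
  rewrite paddr_eq0 // !mulf_eq0 (gt_eqF t0) (gt_eqF t1') /=.
  by move=> /andP[/eqP-> /eqP->].
split; [apply: (flow_tip_inj injS Ay Af)|apply: (flow_tip_inj injS Az Af)] => //;
  by apply/fintype.subsetP => e; rewrite inE; apply: contraNT => /supp[yS zS];
    rewrite ?yS ?zS.
Qed.

(** Moving from f slightly away from g keeps f nonnegative, since g vanishes
    where f does; then f lies strictly between g and another flow. *)
Lemma vertex_support a f g :
  is_vertex (flow_polytope G a) f -> flow_polytope G a g ->
  flow_support g \subset flow_support f -> g = f.
Proof.
move=> [[f0 Mf] vf] [g0 Mg] /fintype.subsetP gf.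
(* t must satisfy t * g <= f: C bounds every ratio g e / f e, and the summand
   2 makes t < 1. *)
pose C := \sum_e g e 0 / f e 0; pose t := (2 + C)^-1.
have q0 e : 0 <= g e 0 / f e 0 by rewrite divr_ge0.
have C0 : 0 <= C by apply: sumr_ge0.
have t0 : 0 < t by rewrite invr_gt0; lra.
have t1 : t < 1 by rewrite invf_lt1; lra.
have t1' : 0 < 1 - t by lra.
pose z := (1 - t)^-1 *: (f - t *: g).
have fE : f = t *: g + (1 - t) *: z.
  by rewrite scalerA mulfV ?gt_eqF // scale1r addrC subrK.
suff Az : flow_polytope G a z by case: (vf g z t _ Az _ fE); rewrite ?t0.
split=> [e|]; last first.
  rewrite -scalemxAr mulmxBr -scalemxAr Mf Mg -{1}[map_mx _ _]scale1r -scalerBl.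
  by rewrite scalerA mulVf ?scale1r // gt_eqF.
rewrite !mxE mulr_ge0 ?invr_ge0 ?(ltW t1') // subr_ge0.
have [fe|fe] := eqVneq (f e 0) 0.
  have /negPn/eqP-> : ~~ (g e 0 != 0).
    by apply/negP => h; have := gf e; rewrite !inE fe eqxx => /(_ h).
  by rewrite mulr0.
have fp : 0 < f e 0 by rewrite lt_neqAle eq_sym fe f0.
have qC : g e 0 / f e 0 <= C.
  by rewrite /C (bigD1 e) //= lerDl sumr_ge0.
rewrite -[g e 0](divfK fe) mulrA ger_pMl // /t mulrC ler_pdivrMr; lra.
Qed.

(** * The integer flow of a fork *)

Definition count_flow es : 'cV[R]_(nb_edges G) := \col_e (count_mem e es)%:R.

Lemma mul_count_flow es :
  M *m count_flow es = \sum_(s <- map (@edges n G) es) @sedge_vec R n s.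
Proof.
elim: es => [|e es IH].
  by rewrite big_nil (_ : count_flow _ = 0) ?mulmx0 //; apply/colP => e; rewrite !mxE.
rewrite big_cons -IH (_ : count_flow _ = delta_mx e 0 + count_flow es).
  by rewrite mulmxDr -colE; congr (_ + _); apply/colP => i; rewrite !mxE.
by apply/colP => e'; rewrite !mxE /= natrD andbT eq_sym.
Qed.

Lemma count_flow_support es : flow_support (count_flow es) =i es.
Proof. by move=> e; rewrite inE mxE pnatr_eq0 -lt0n -has_count has_pred1. Qed.

Lemma sum_neg_path x p :
  \sum_(s <- neg_path x p) @sedge_vec R n s = delta_mx x 0 - delta_mx (last x p) 0.
Proof.
elim: p x => [|y p IH] x; first by rewrite big_nil subrr.
by rewrite big_cons IH /= addrA subrK.
Qed.

(** The stem is counted twice because each branch draws one unit from it. *)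
Lemma sum_fork p vs ws :
  \sum_(s <- neg_path ord0 p ++ fork p vs ws) @sedge_vec R n s
  = map_mx intr (source_two n).
Proof.
rewrite /fork !big_cat !sum_neg_path big_seq1 /=.
apply/colP => v; rewrite !mxE !andbT.
by case: (v =P ord0) => _ /=; ring.
Qed.

Lemma sum_same_sedge ss ts : all2 (@same_sedge n) ss ts ->
  \sum_(s <- ss) @sedge_vec R n s = \sum_(s <- ts) @sedge_vec R n s.
Proof.
elim: ss ts => [|s ss IH] [|t ts] //= /andP[st /IH].
rewrite !big_cons => ->; congr (_ + _).
move: s t st => [i j|i j] [k l|k l] //= => [/andP[/eqP-> /eqP->] //|].
by case/orP=> /andP[/eqP-> /eqP->] //; rewrite addrC.
Qed.

(** The stem comes first in a fork, so [take (size p)] picks its edges. *)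
Lemma fork_flow p vs ws es :
  all2 (@same_sedge n) (map (@edges n G) es) (fork p vs ws) ->
  integer_flow G (source_two n) (count_flow (take (size p) es ++ es)).
Proof.
move=> hes; split; last by move=> e; rewrite mxE.
split=> [e|]; first by rewrite mxE ler0n.
rewrite mul_count_flow -(sum_fork p vs ws); apply: sum_same_sedge.
have take_fork : take (size p) (fork p vs ws) = neg_path ord0 p.
  by rewrite take_size_cat // size_pairmap.
by rewrite map_cat map_take -take_fork all2_cat ?all2_take.
Qed.

(** * A fork in the support of a flow *)

Section Support.
Variable f : 'cV[R]_(nb_edges G).
Hypothesis f_flow : flow_polytope G (source_two n) f.

Definition supp_adj : rel 'I_n.+1 := fun u v =>
  [exists e in flow_support f, same_sedge (edges e) (Neg u v)].

Lemma supp_adj_below : subrel supp_adj (@below n).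
Proof.
move=> u v /existsP[e /andP[_ /same_sedge_NegP ee]].
by have := edge_ordered e; rewrite ee.
Qed.

(** Positive edges alone contribute to the total net flow, which is 2. *)
Lemma exists_supp_pos : exists e a b, e \in flow_support f /\ edges e = Pos a b.
Proof.
have [e /andP[he te]|none] := pickP (fun e => (f e 0 != 0) && (tip (edges e) == None)).
  by case ee: (edges e) te => [//|a b] _; exists e, a, b; rewrite inE.
have := sum_net_flow f; case: f_flow => _ ->.
rewrite [RHS]big1 => [|e te].
  rewrite (bigD1 ord0) //= big1 => [|i /negbTE ne]; rewrite !mxE ?ne //= addr0.
  by move/eqP; rewrite intr_eq0.
by have := none e; rewrite te andbT => /negPn/eqP->; rewrite mulr0.
Qed.

(** Trace the flow backwards: away from the source, what leaves v is balanced
    by a negative edge entering v, and that edge leaves a smaller vertex. *)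
Lemma supp_reach e v :
  e \in flow_support f -> 0 < sedge_vec R (edges e) v 0 ->
  connect supp_adj ord0 v.
Proof.
have [m] := ubnP (v : nat); elim: m e v => // m IH e v hm eS vec_gt0.
have [->|v0] := eqVneq v ord0; first exact: connect0.
have [f0 Mf] := f_flow.
have [/existsP[e' /andP[eS' lt0]]|none] :=
  boolP [exists e', (e' \in flow_support f) && (sedge_vec R (edges e') v 0 < 0)].
  have [u ee'] : exists u, edges e' = Neg u v.
    move: lt0; rewrite sedge_vecE; case: (edges e') => [i j|i j]; last first.
      by rewrite ltNge addr_ge0 ?ler0n.
    by case: (v =P j) => [->|_]; [exists i|rewrite subr0 ltNge ler0n].
  have uv : supp_adj u v.
    by apply/existsP; exists e'; rewrite eS' ee' same_sedge_refl.
  have /= lt_uv := supp_adj_below uv.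
  apply: connect_trans (connect1 uv); apply: (IH e') => //.
    exact: leq_trans lt_uv _.
  have /negbTE ne : u != v by apply: contraTneq lt_uv => ->; rewrite /below /= ltnn.
  by rewrite ee' sedge_vecE eqxx ne subr0 ltr01.
have := signed_mxE f v; rewrite Mf !mxE (negbTE v0) => /esym/eqP.
rewrite psumr_eq0 => [/allP/(_ e)|e' _].
  rewrite mem_index_enum => /(_ isT); rewrite mulf_eq0 gt_eqF //=.
  by move: eS; rewrite inE => /negbTE->.
have [->|he'] := eqVneq (f e' 0) 0; first by rewrite mulr0.
rewrite mulr_ge0 // leNgt; apply: contra none => lt0.
by apply/existsP; exists e'; rewrite inE he'.
Qed.

Lemma lift_neg_path x p :
  path supp_adj x p ->
  exists es, {subset es <= flow_support f} /\ map (@edges n G) es = neg_path x p.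
Proof.
elim: p x => [|y p IH] x /=; first by exists [::].
case/andP=> /existsP[e /andP[eS /same_sedge_NegP ee]] /IH[es [esS ees]].
exists (e :: es); split=> [e'|]; last by rewrite /= ee ees.
by rewrite inE => /orP[/eqP->|/esS].
Qed.

Lemma supp_fork : exists p vs ws es,
  [/\ uniq (last ord0 p :: vs ++ ws), vs == [::] -> ws == [::],
      {subset es <= flow_support f}
    & all2 (@same_sedge n) (map (@edges n G) es) (fork p vs ws)].
Proof.
have [e [a [b [eS ee]]]] := exists_supp_pos.
have reach v : v \in [:: a; b] -> connect supp_adj ord0 v.
  rewrite !inE => vab; apply: (supp_reach eS); rewrite ee sedge_vecE.
  by case/orP: vab => ->; [apply: ltr_wpDr|apply: ltr_wpDl]; rewrite ?ler0n ?ltr01.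
have /connectP[sa pa la] := reach a (mem_head _ _).
have /connectP[sb pb lb] := reach b (mem_last a [:: b]).
have [p [vs [ws [hv hw u lv lw]]]] := fork_of_paths supp_adj_below pb pa.
have {la pa lb pb sa sb reach lv lw} :
    same_sedge (edges e) (Pos (last (last ord0 p) ws) (last (last ord0 p) vs)).
  by rewrite ee lv lw -la -lb same_sedge_refl.
(* A positive edge does not order its ends, so the branches can be swapped. *)
wlog empt : vs ws hv hw u / vs == [::] -> ws == [::] => [hwlog|] ev.
  have [vs0|/negbTE vs0] := boolP (vs == [::]); last first.
    by apply: (hwlog vs ws) => //; rewrite vs0.
  apply: (hwlog ws vs) => //; last by move: ev; rewrite ee same_sedge_Posr.
  by rewrite /= mem_cat orbC -mem_cat uniq_catC.
move: hv hw; rewrite !cat_path => /andP[/lift_neg_path[ep [sp ep_eq]] hv].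
case/andP=> _ /lift_neg_path[ew [sw ew_eq]].
move: hv => /lift_neg_path[ev' [sv ev_eq]].
exists p, vs, ws, (ep ++ ev' ++ ew ++ [:: e]); split=> //.
  move=> e'; rewrite !mem_cat inE => /or4P[/sp|/sv|/sw|/eqP->] //.
have refl q : all2 (@same_sedge n) q q.
  by elim: q => //= s q ->; rewrite same_sedge_refl.
by rewrite !map_cat ep_eq ev_eq ew_eq !all2_cat ?refl //= ev.
Qed.

End Support.

Lemma all2_map_tip es L :
  all2 (@same_sedge n) (map (@edges n G) es) L ->
  map (fun e => tip (edges e)) es = map (@tip n) L /\ all (@ordered n) L.
Proof.
elim: es L => [|e es IH] [|s L] //= /andP[es_ /IH[-> ->]].
by rewrite (same_sedge_tip es_) -(same_sedge_ordered es_) edge_ordered.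
Qed.

End Flows.

(** * Vertices of the flow polytope *)

Theorem theorem3p13 (R : realType) (n : nat) (G : signed_graph n)
    (f : 'cV[R]_(nb_edges G)) (hf : flow_polytope G (source_two n) f) :
  is_vertex (flow_polytope G (source_two n)) f <->
  exists (S : {set 'I_(nb_edges G)}) (L : seq (sedge n)),
    vertex_form L /\ realizes S L /\
    unique (fun g : 'cV[R]_(nb_edges G) =>
              integer_flow G (source_two n) g /\ flow_support g = S) f.
Proof.
split=> [vf|[S [L [vL [[es [_ Ses esL]] [[_ fS] _]]]]]]; last first.
  have [tipL ordL] := all2_map_tip esL.
  have inj := uniq_map_inj (etrans (congr1 uniq tipL) (vertex_form_tip_uniq vL ordL)).
  apply: (tip_inj_vertex (S := S)) => //; last by rewrite fS.
  by move=> e e'; rewrite !Ses; apply: inj.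
have [p [vs [ws [es [u empt es_f esL]]]]] := supp_fork hf.
have [tipL ordL] := all2_map_tip esL.
have [flow_es int_es] := fork_flow R esL.
have supp_es e : (e \in take (size p) es ++ es) = (e \in es).
  by rewrite mem_cat orb_idl // => /mem_take.
have fE : count_flow R (take (size p) es ++ es) = f.
  apply: vertex_support vf flow_es _; apply/fintype.subsetP => e.
  by rewrite count_flow_support supp_es => /es_f.
exists (flow_support f), (fork p vs ws); split; first exact: fork_vertex_form.
split.
  exists es; split=> //; last by move=> e; rewrite -fE count_flow_support supp_es.
  by apply: (@map_uniq _ _ (fun e => tip (edges e))); rewrite tipL fork_tip_uniq.
split; first by rewrite -fE.
by move=> g [[flow_g _] gf]; apply/esym/(vertex_support vf); rewrite ?gf.
Qed.
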